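(* Any streaming certification scheme for $\mathrm{Degeneracy}_{\leq 1}$ whose verifier uses $m$ bits of memory and whose certificates have $c$ bits satisfies $c+m=\Omega(n)$ on $n$-node graphs.
   Context: A graph is $k$-degenerate if every subgraph has a vertex of degree at most $k$; the degeneracy of $G$ is the smallest such $k$. $\mathrm{Degeneracy}_{\leq 1}$ is the decision problem (with fixed threshold $1$) taking as input a graph $G$ and asking whether its degeneracy is at most $1$. The $n$-node input graph on $[n]$ is given as a stream of edges in an arbitrary, possibly adversarial, order. A streaming certification scheme for a decision problem $P$ consists of a prover (a computationally unlimited function producing a certificate in $\{0,1\}^*$ depending only on the input graph, not on the edge order) and a verifier (a deterministic streaming algorithm with read-only access to the certificate that processes the stream and outputs accept or reject). Completeness: if $G$ satisfies $P$, some certificate makes the verifier accept for every edge order. Soundness: if $G$ does not satisfy $P$, the verifier rejects for every certificate and every edge order. $c$ is the certificate length and $m$ the verifier's memory excluding the certificate, as worst-case functions of $n$. *)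

(* Defs.v *)
From mathcomp Require Import all_boot.

Set Implicit Arguments.
Unset Strict Implicit.
Unset Printing Implicit Defensive.

(* Simple graphs on the vertex set 'I_n. *)
Record graph (n : nat) := Graph {
  edges : {set {set 'I_n}};
  edges_card2 : [forall e in edges, #|e| == 2]
}.

(* (W, F) is a subgraph of G: not necessarily induced. *)
Definition subgraph n (G : graph n) (W : {set 'I_n}) (F : {set {set 'I_n}}) :=
  (F \subset edges G) && [forall e in F, e \subset W].

Definition degree n (F : {set {set 'I_n}}) (v : 'I_n) : nat :=
  #|[set e in F | v \in e]|.

(* The subgraph with no vertices is excluded from "every subgraph". *)
Definition degenerate n (G : graph n) (k : nat) : bool :=
  [forall W : {set 'I_n}, forall F : {set {set 'I_n}},
     (W != set0) && subgraph G W F ==> [exists v in W, degree F v <= k]].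

Lemma degenerate_ex n (G : graph n) : exists k, degenerate G k.
Proof.
exists #|{set 'I_n}|; apply/forallP=> W; apply/forallP=> F.
apply/implyP=> /andP[/set0Pn[v vW] _]; apply/existsP; exists v.
by rewrite vW max_card.
Qed.

Definition degeneracy n (G : graph n) : nat := ex_minn (degenerate_ex G).

Definition problem := forall n : nat, graph n -> bool.

Definition degeneracy_le (k : nat) : problem := fun n G => degeneracy G <= k.

Definition edge_stream n (G : graph n) (s : seq {set 'I_n}) : bool :=
  perm_eq s (enum (edges G)).

(* A deterministic one-pass streaming algorithm on n-vertex graphs. The first
   argument of each component is the certificate, which can be read at any time
   and is not part of the memory; the memory contents are a bit string. Time and
   uniformity in n are unrestricted. *)
Record verifier (n : nat) := Verifier {
  init   : seq bool -> seq bool;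
  step   : seq bool -> seq bool -> {set 'I_n} -> seq bool;
  output : seq bool -> seq bool -> bool
}.

Definition accepts n (V : verifier n) (w : seq bool) (s : seq {set 'I_n}) :=
  output V w (foldl (step V w) (init V w) s).

(* scanl omits the initial memory contents. *)
Definition memory_trace n (V : verifier n) (w : seq bool)
    (s : seq {set 'I_n}) : seq (seq bool) :=
  init V w :: scanl (step V w) (init V w) s.

(* The prover sees the graph only, hence its certificate cannot depend on the
   order of the stream. *)
Record certification_scheme (P : problem) := CertificationScheme {
  prover : forall n, graph n -> seq bool;
  verif : forall n, verifier n;
  completeness : forall n (G : graph n) (s : seq {set 'I_n}),
    P n G -> edge_stream G s -> accepts (verif n) (prover G) s;
  soundness : forall n (G : graph n) (w : seq bool) (s : seq {set 'I_n}),
    ~~ P n G -> edge_stream G s -> ~~ accepts (verif n) w s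
}.

(* The certificates that matter are those of the positive instances. *)
Definition certificate_bits (P : problem) (S : certification_scheme P)
    (c : nat -> nat) : Prop :=
  forall n (G : graph n), P n G -> size (prover S G) <= c n.

(* Worst case over all n-vertex graphs, all edge orders, all points in time and
   all certificates of at most c n bits, honest or not. *)
Definition memory_bits (P : problem) (S : certification_scheme P)
    (c m : nat -> nat) : Prop :=
  forall n (G : graph n) (w : seq bool) (s : seq {set 'I_n}) (q : seq bool),
    size w <= c n -> edge_stream G s ->
    q \in memory_trace (verif S n) w s -> size q <= m n.

(* Main.v *)
Require Import Defs.
From mathcomp Require Import all_boot all_order all_algebra.
From mathcomp Require Import all_classical all_reals all_analysis.
From mathcomp Require Import zify lra.

Import fintype boot.finset.
Import GRing.Theory Num.Theory numFieldNormedType.Exports.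

Set Implicit Arguments.
Unset Strict Implicit.

(** Fooling-set argument.  For a set [X] of indices consider the forest made of
    a hub and two vertices [a_i], [b_i] for each index [i], with the edge
    [a_i b_i] (first half of the stream) when [i] is outside [X], and the edges
    from the hub to [a_i] and [b_i] (second half) when [i] is in [X].  If two
    sets had the same honest certificate and the same memory contents after the
    first half, the verifier would also accept the first half of either one
    followed by the second half of the other; but one of these two graphs
    contains a triangle.  Hence certificate and memory contents together take at
    least as many values as there are sets [X], of which there are [2 ^ k] with
    [k] about [n / 2]. *)

Lemma degenerateS {n} (G : graph n) (k l : nat) :
  k <= l -> degenerate G k -> degenerate G l.
Proof.
move=> kl /forallP dG; apply/forallP => W; apply/forallP => F; apply/implyP => H.
have /existsP[v /andP[vW dv]] := implyP (forallP (dG W) F) H.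
by apply/existsP; exists v; rewrite vW (leq_trans dv).
Qed.

Lemma degeneracy_leE {n} (G : graph n) (k : nat) :
  (degeneracy G <= k) = degenerate G k.
Proof.
rewrite /degeneracy; case: ex_minnP => d dG dmin.
by apply/idP/idP => [dk|/dmin//]; exact: degenerateS dG.
Qed.

Lemma degree_gt1 {n} (F : {set {set 'I_n}}) (u : 'I_n) (e1 e2 : {set 'I_n}) :
  e1 != e2 -> e1 \in F -> e2 \in F -> u \in e1 -> u \in e2 -> 1 < degree F u.
Proof.
move=> ne e1F e2F ue1 ue2; have <- : #|[set e1; e2]| = 2 by rewrite cards2 ne.
apply/subset_leq_card/subsetP => e; rewrite !inE.
by case/orP => /eqP->; apply/andP.
Qed.

Lemma card_bseq_bool_lt (n : nat) : #|{: n.-bseq bool}| < 2 ^ n.+1.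
Proof.
rewrite card_bseq card_bool; elim: n => [|n IHn]; first by rewrite big_ord1.
by rewrite big_ord_recr /= [X in _ < X]expnS mul2n -addnn ltn_add2r.
Qed.

(** Makes the bound of [memory_bits] available for the contents at the cut between the two halves of
    a stream. *)
Lemma mem_memory_trace {n} (V : verifier n) (w : seq bool)
    (s t : seq {set 'I_n}) :
  foldl (step V w) (init V w) s \in memory_trace V w (s ++ t).
Proof.
have H : size s <= size (s ++ t) by rewrite size_cat leq_addr.
rewrite -[in X in foldl _ _ X](take_size_cat t (erefl (size s))).
rewrite -(nth_cons_scanl [::] _ H).
by apply: mem_nth; rewrite /= size_scanl ltnS.
Qed.

Lemma fooling_set_bound (P : problem) (S : certification_scheme P)
    (c m : nat -> nat) (hc : certificate_bits S c) (hm : memory_bits S c m)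
    (n : nat) (I : finType) (A B : I -> seq {set 'I_n}) (G : I -> I -> graph n) :
    (forall i j, edge_stream (G i j) (A i ++ B j)) ->
    (forall i, P n (G i i)) ->
    (forall i j, i != j -> ~~ P n (G i j) || ~~ P n (G j i)) ->
  #|I| <= 2 ^ (c n + m n).+2.
Proof.
move=> strG posG crossG.
pose w i := prover S (G i i).
pose q i := foldl (step (verif S n) (w i)) (init (verif S n) (w i)) (A i).
have w_size i : size (w i) <= c n by exact/hc/posG.
have q_size i : size (q i) <= m n.
  exact: hm (w_size i) (strG i i) (mem_memory_trace _ _ _ _).
(* With certificate [w j], the streams [A i ++ B j] and [A j ++ B j] lead to the same final memory;
   the second is accepted by completeness, so soundness forbids [G i j] to be negative. *)
have cross_accepts i j : w i = w j -> q i = q j -> P n (G i j).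
  move=> eqw eqq; apply: contraT => /soundness/(_ (strG i j))-/(_ S (w j)).
  have := completeness S (posG j) (strG j j).
  by rewrite /accepts !foldl_cat -/(w j) -/(q j) -eqq /q eqw => ->.
pose f i : (c n).-bseq bool * (m n).-bseq bool :=
  (Bseq (w_size i), Bseq (q_size i)).
have f_inj : injective f.
  move=> i j [eqw eqq]; apply/eqP; apply: contraT => /crossG.
  by rewrite !cross_accepts.
apply: leq_trans (leq_card f f_inj) _.
(* Strings of length at most [l] number less than [2 ^ l.+1], whence one extra bit for each
   factor. *)
rewrite card_prod -addSn -addnS expnD.
by rewrite leq_mul // ltnW // card_bseq_bool_lt.
Qed.

Section HubGraph.

(* [v None] is the hub, [v (Some (i, false))] and [v (Some (i, true))] are
   [a_i] and [b_i]. *)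
Variables (n k : nat) (v : option ('I_k * bool) -> 'I_n).
Hypothesis v_inj : injective v.

Let rim (i : 'I_k) : {set 'I_n} := [set v (Some (i, false)); v (Some (i, true))].
Let spoke (p : 'I_k * bool) : {set 'I_n} := [set v None; v (Some p)].

Definition rims (X : {set 'I_k}) : {set {set 'I_n}} := [set rim i | i in ~: X].
Definition spokes (X : {set 'I_k}) : {set {set 'I_n}} :=
  [set spoke p | p : 'I_k * bool & p.1 \in X].

Let mem_rim i p : (v (Some p) \in rim i) = (p.1 == i).
Proof.
rewrite !inE !(inj_eq v_inj) !(inj_eq Some_inj).
by case: p => j []; rewrite !xpair_eqE /= ?andbT ?andbF ?orbF.
Qed.

Let mem_spoke q p : (v (Some p) \in spoke q) = (p == q).
Proof. by rewrite !inE !(inj_eq v_inj). Qed.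

Let hub_rim i : v None \notin rim i.
Proof. by rewrite !inE !(inj_eq v_inj). Qed.

Lemma hub_edges_card2 (X Y : {set 'I_k}) :
  [forall e in rims X :|: spokes Y, #|e| == 2].
Proof.
apply/forall_inP => e; rewrite inE => /orP[] /imsetP[x _ ->];
  rewrite cards2 (inj_eq v_inj) //.
by rewrite (inj_eq Some_inj) xpair_eqE andbF.
Qed.

Definition hub_graph (X Y : {set 'I_k}) : graph n := Graph (hub_edges_card2 X Y).

Lemma hub_graph_stream (X Y : {set 'I_k}) :
  edge_stream (hub_graph X Y) (enum (rims X) ++ enum (spokes Y)).
Proof.
apply: uniq_perm; last by move=> e; rewrite mem_cat !mem_enum inE.
  (* The halves are disjoint: every spoke contains the hub, no rim does. *)
  rewrite cat_uniq !enum_uniq andbT /=; apply/hasPn => e.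
  rewrite !mem_enum => /imsetP[p _ ->]; apply/imsetP => -[i _ eq_e].
  by have := hub_rim i; rewrite -eq_e set21.
exact: enum_uniq.
Qed.

Lemma hub_graph_degenerate (X : {set 'I_k}) : degenerate (hub_graph X X) 1.
Proof.
apply/forallP => W; apply/forallP => F.
apply/implyP => /andP[/set0Pn[u uW] /andP[/subsetP FG /forall_inP FW]].
have [/existsP[p pW]|noW] := boolP [exists p, v (Some p) \in W].
  apply/existsP; exists (v (Some p)); rewrite pW /=.
  (* The only edge of the graph at [v (Some p)] is its spoke or its rim, according to [X]. *)
  rewrite -(cards1 (if p.1 \in X then spoke p else rim p.1)).
  apply/subset_leq_card/subsetP => e; rewrite !inE => /andP[/FG eG].
  move: eG; rewrite inE => /orP[] /imsetP[x xX ->].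
    by move: xX; rewrite mem_rim inE => /[swap] /eqP-> /negPf->.
  by move: xX; rewrite mem_spoke inE => /[swap] /eqP-> ->.
(* Every edge has an endpoint other than the hub, so here [F] is empty and any [u] in [W] will
   do. *)
apply/existsP; exists u; rewrite uW /degree /=.
rewrite eq_card0 // => e; rewrite !inE; apply/negbTE/negP => /andP[eF _].
have /subsetP eW := FW e eF.
have [p pe] : exists p, v (Some p) \in e.
  have := FG e eF; rewrite inE => /orP[] /imsetP[x _ ->].
    by exists (x, true); rewrite mem_rim.
  by exists x; rewrite mem_spoke.
by case/existsP: noW; exists p; exact: eW.
Qed.

(** For [i] in [Y] but not in [X], both spokes and the rim of [i] are present; in this triangle all
    degrees are 2. *)
Lemma hub_graph_triangle (X Y : {set 'I_k}) :
  ~~ (Y \subset X) -> ~~ degenerate (hub_graph X Y) 1.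
Proof.
case/subsetPn => i iY iX; apply/negP.
pose a := spoke (i, false); pose b := spoke (i, true).
have ab : a != b.
  apply/eqP => /setP/(_ (v (Some (i, true)))).
  by rewrite !mem_spoke eqxx xpair_eqE andbF.
have ar : a != rim i.
  by apply/eqP => ar; have := hub_rim i; rewrite -ar set21.
have br : b != rim i.
  by apply/eqP => br; have := hub_rim i; rewrite -br set21.
pose F := [set a; b; rim i].
move=> /forallP/(_ (v None |: rim i))/forallP/(_ F)/implyP dF.
have /dF/existsP[u /andP[uW]] :
    (v None |: rim i != set0) && subgraph (hub_graph X Y) (v None |: rim i) F.
  apply/andP; split; first by apply/set0Pn; exists (v None); rewrite setU11.
  apply/andP; split.
    apply/subsetP => e; rewrite !inE -orbA => /or3P[] /eqP->; apply/orP.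
    - by right; apply: imset_f; rewrite inE.
    - by right; apply: imset_f; rewrite inE.
    - by left; apply: imset_f; rewrite inE.
  apply/forall_inP => e; rewrite !inE -orbA => /or3P[] /eqP->.
  - by rewrite setUS // sub1set mem_rim.
  - by rewrite setUS // sub1set mem_rim.
  - exact: subsetUr.
apply/negP; rewrite -ltnNge; move: uW; rewrite !inE => /or3P[] /eqP->.
- by apply: degree_gt1 ab _ _ _ _; rewrite !inE ?eqxx ?orbT.
- by apply: degree_gt1 ar _ _ _ _; rewrite !inE ?eqxx ?orbT.
- by apply: degree_gt1 br _ _ _ _; rewrite !inE ?eqxx ?orbT.
Qed.

End HubGraph.

Lemma degeneracy_le1_bits (S : certification_scheme (degeneracy_le 1))
    (c m : nat -> nat) (hc : certificate_bits S c) (hm : memory_bits S c m)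
    (n k : nat) :
  k.*2 < n -> k <= (c n + m n).+2.
Proof.
move=> kn.
(* The hub and the [k] pairs take [2k + 1] vertices; the others stay isolated. *)
have cardn : #|{: option ('I_k * bool)}| <= n.
  by rewrite card_option card_prod card_ord card_bool muln2.
pose v x := widen_ord cardn (enum_rank x).
have v_inj : injective v.
  by move=> x y /(congr1 val) /= /val_inj /enum_rank_inj.
rewrite -(leq_exp2l (m := 2)) // -[X in 2 ^ X](card_ord k) -cardsT -card_powerset.
rewrite powersetT cardsT.
apply: (fooling_set_bound hc hm (hub_graph_stream v_inj)).
  by move=> X; rewrite /degeneracy_le degeneracy_leE hub_graph_degenerate.
move=> X Y; rewrite eqEsubset negb_and /degeneracy_le !degeneracy_leE orbC.
by case/orP => /(hub_graph_triangle v_inj) ->; rewrite ?orbT.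
Qed.

Unset Implicit Arguments.
Set Strict Implicit.

Local Open Scope classical_set_scope.
Local Open Scope ring_scope.

Theorem theorem11 (R : realType) (S : certification_scheme (degeneracy_le 1))
    (c m : nat -> nat)
    (hc : certificate_bits S c) (hm : memory_bits S c m) :
  (fun n : nat => (c n + m n)%:R : R) \is 'Omega_\oo (fun n : nat => n%:R : R).
Proof.
(* Taking [k = n.-1./2] gives [c n + m n >= n/2 - 3], which is at least [n/4] once [n >= 12]. *)
rewrite qualifE; apply/asboolP; exists (1 / 4); first by lra.
near=> n.
have n12 : (12 <= n)%N by near: n; exact: nbhs_infty_ge.
have lb := @degeneracy_le1_bits S c m hc hm n n.-1./2 ltac:(lia).
have : n%:R <= (4 * (c n + m n))%:R :> R by rewrite ler_nat; lia.
by rewrite !normr_nat natrM; lra.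
Unshelve. all: by end_near.
Qed.
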